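(* Let $m\ge2$, let $W_1,W_2$ be two distinct $2$-dimensional $\mathbb{F}_{q^m}$-subspaces of $\mathbb{F}_{q^m}^3$, and let $U_1\subseteq W_1$, $U_2\subseteq W_2$ be scattered $\mathbb{F}_q$-subspaces with $\dim_{\mathbb{F}_q}U_1=\dim_{\mathbb{F}_q}U_2=m$ whose linear sets $L_{U_1}$ and $L_{U_2}$ are disjoint. Then the geometric dual $\mathcal{C}(U_1^{\perp'},U_2^{\perp'})$ of a code associated with $(U_1,U_2)$ is a minimal sum-rank metric code, and it satisfies the AB-condition if and only if $q=2$. Moreover, the (rank-metric) codes associated with $U_1^{\perp'}$ and with $U_2^{\perp'}$, respectively, are not minimal.
   Context: Let $q$ be a prime power. For $\mathbf{n}=(n_1,\ldots,n_t)$ put $\mathbb{F}_{q^m}^{\mathbf{n}}=\bigoplus_{i=1}^t\mathbb{F}_{q^m}^{n_i}$. The rank of $v\in\mathbb{F}_{q^m}^n$ is the $\mathbb{F}_q$-dimension of the $\mathbb{F}_q$-span of its entries; the rank-list of $x=(x_1,\ldots,x_t)$ is $(\mathrm{rk}(x_1),\ldots,\mathrm{rk}(x_t))$, and its sum-rank weight is $\sum_i\mathrm{rk}(x_i)$. An $[\mathbf{n},k]_{q^m/q}$ code is a $k$-dimensional $\mathbb{F}_{q^m}$-subspace of $\mathbb{F}_{q^m}^{\mathbf{n}}$ with the sum-rank distance; for $t=1$ this is a rank-metric code. A code associated with a tuple $(V_1,\ldots,V_t)$ of $\mathbb{F}_q$-subspaces of $\mathbb{F}_{q^m}^k$ whose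 $\mathbb{F}_{q^m}$-span is $\mathbb{F}_{q^m}^k$ is the code generated by $(G_1|\cdots|G_t)$, where the columns of $G_i$ form an $\mathbb{F}_q$-basis of $V_i$. Dual: fix a nondegenerate reflexive sesquilinear form $\sigma$ on $V=\mathbb{F}_{q^m}^k$ and let $\sigma'(x,y)=\mathrm{Tr}_{q^m/q}(\sigma(x,y))$, regarded as a nondegenerate reflexive sesquilinear form on $V$ seen as a $km$-dimensional $\mathbb{F}_q$-space. For an $\mathbb{F}_q$-subspace $U$ of $V$, $U^{\perp'}$ is its orthogonal complement with respect to $\sigma'$. The geometric dual $\mathcal{C}(U_1^{\perp'},\ldots,U_t^{\perp'})$ of a code associated with $(U_1,\ldots,U_t)$ (defined when $U_1\cap\cdots\cap U_t$ contains no $1$-dimensional $\mathbb{F}_{q^m}$-subspace) is a code associated with $(U_1^{\perp'},\ldots,U_t^{\perp'})$. Linear sets: for an $\mathbb{F}_q$-subspace $U$ of $\mathbb{F}_{q^m}^k$, $L_U=\{\langle u\rangle_{\mathbb{F}_{q^m}}:u\in U\setminus\{0\}\}\subseteq\mathrm{PG}(k-1,q^m)$. $U$ is scattered if $\dim_{\mathbb{F}_q}(U\cap\langle v\rangle_{\mathbb{F}_{q^m}})\le1$ for all $v\ne0$. Minimality: fix an $\mathbb{F}_q$-basis of $\mathbb{F}_{q^m}$; for $x_i\in\mathbb{F}_{q^m}^{n_i}$ let $\Gamma(x_i)\in\mathbb{F}_q^{n_i\times m}$ be the matrix whose $j$-th row consists of the coordinates of the $j$-th entry of $x_i$. The sum-rank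 support of $x$ is the tuple of $\mathbb{F}_q$-column spaces of $\Gamma(x_1),\ldots,\Gamma(x_t)$; inclusion is componentwise. A code $\mathcal{C}$ is minimal if for all $c,c'\in\mathcal{C}$, whenever the support of $c'$ is contained in that of $c$, $c'=\lambda c$ for some $\lambda\in\mathbb{F}_{q^m}$. AB-condition: an $[(\nu_1,\ldots,\nu_t),k]_{q^m/q}$ code $\mathcal{C}$ satisfies the AB-condition if $\delta_{\max}/\delta_{\min}<q^m/(q^m-1)$, where $\delta_{\max}$ and $\delta_{\min}$ are the maximum and minimum of $\sum_{i=1}^t\frac{q^{\nu_i}-q^{\nu_i-r_i}}{q-1}$ over the rank-lists $(r_1,\ldots,r_t)$ of nonzero codewords of $\mathcal{C}$. *)

(* Defs.v *)
From HB Require Import structures.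
From mathcomp Require Import all_boot all_order all_algebra all_fingroup all_field.
From mathcomp Require Import sesquilinear.

Set Implicit Arguments.
Unset Strict Implicit.
Unset Printing Implicit Defensive.

Import GRing.Theory.
Local Open Scope ring_scope.

(* F is F_q and L is F_(q^m): every finite extension of a finite field is a
   splitting field, so taking L : splittingFieldType F loses nothing and makes
   the library trace galTrace available.
   The space L^k carries two vector space structures on convertible types:
   Fvec L k is a vectType over F, Lvec L k a vectType over L. *)
Notation Fvec L k := {ffun 'I_k -> L}.
Notation Lvec L k := {ffun 'I_k -> L^o}.

Section Spaces.
Variables (F : finFieldType) (L : splittingFieldType F) (k : nat).
Local Notation VF := (Fvec L k).
Local Notation VL := (Lvec L k).
Implicit Types (U : {vspace VF}) (H W : {vspace VL}).

(* W seen as an F-subspace *)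
Definition restr W : {vspace VF} :=
  <<[seq u : VF <- enum (finvect_type VF) | (u : VL) \in W]>>%VS.

Definition Lspan U : {vspace VL} :=
  <<([seq u : VF <- enum (finvect_type VF) | u \in U] : seq VL)>>%VS.

Lemma Fscale_Lscale (a : F) (u : VF) : a *: u = (a%:A : L) *: (u : VL) :> VL.
Proof. by apply/ffunP=> i; rewrite !ffunE [RHS]mulr_algl. Qed.

Lemma mem_restr W (u : VF) : (u \in restr W) = ((u : VL) \in W).
Proof.
apply/idP/idP=> [| Wu].
  rewrite /restr; set s := filter _ _ => /(coord_span (X := in_tuple s)) ->.
  elim/big_rec: _ => [|i x _ Wx]; first exact: mem0v.
  apply: (memvD (U := W)) => //; rewrite Fscale_Lscale memvZ //.
  by have := mem_nth 0 (ltn_ord i : (i < size s)%N); rewrite mem_filter => /andP[].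
apply: (memv_span (K := F) (vT := VF)).
by rewrite mem_filter Wu (mem_enum (T := finvect_type VF)).
Qed.

Lemma LspanP U H :
  (Lspan U <= H)%VS <-> (forall u : VF, u \in U -> (u : VL) \in H).
Proof.
split=> [sUH u Uu | sUH].
  apply: (subvP sUH); apply: (memv_span (K := L) (vT := VL)).
  by rewrite mem_filter Uu (mem_enum (T := finvect_type VF)).
apply/span_subvP=> u; rewrite mem_filter => /andP[Uu _]; exact: sUH.
Qed.

Definition scattered U : Prop :=
  forall v : VL, v != 0 -> (\dim (U :&: restr <[v]>) <= 1)%N.

(* points of PG(k-1, q^m) are the 1-dimensional L-subspaces of L^k *)
Definition linear_set U (P : {vspace VL}) : Prop :=
  exists u : VF, [/\ u \in U, u != 0 & P = <[u : VL]>%VS].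

Definition disjoint_linear_sets U1 U2 : Prop :=
  forall P, ~ (linear_set U1 P /\ linear_set U2 P).

Section Forms.
Variable theta : {rmorphism L -> L}.
Variable sigma : {bilinear VL -> VL -> L | *%R & theta \; *%R}.

Definition reflexive_form : Prop :=
  forall x y : VL, sigma x y = 0 -> sigma y x = 0.

Definition nondegenerate_form : Prop :=
  forall x : VL, (forall y : VL, sigma x y = 0) -> x = 0.

(* Tr_(q^m/q) (sigma (x, y)), with values in 1%VS, the copy of F in L *)
Definition trace_form (x y : VF) : L := galTrace 1 {:L} (sigma x y).

(* The orthogonal complement is taken in the first (linear) argument; when the
   trace form is reflexive both sides agree. Reflexivity of sigma alone does not
   imply it: sigma may be a scalar multiple of a hermitian form. *)
Definition perp U : {vspace VF} :=
  (\bigcap_(u : finvect_type VF | (u : VF) \in U)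
     lker (linfun (fun x : VF => trace_form x u)))%VS.

Fact trace_form_is_linear (y : VF) :
  linear (fun x : VF => trace_form x y : L).
Proof.
move=> a u v; rewrite /trace_form.
have -> : sigma (a *: u + v) y = a *: sigma u y + sigma v y.
  rewrite (_ : sigma _ _ = sigma ((a%:A : L) *: (u : VL) + v) y).
    by rewrite linearPl /= mulr_algl.
  by congr (sigma _ _); rewrite -Fscale_Lscale.
rewrite raddfD /=; congr (_ + _); rewrite /galTrace scaler_sumr.
by apply: eq_bigr => g _; rewrite linearZ.
Qed.

Lemma perpP U (x : VF) :
  x \in perp U <-> (forall u : VF, u \in U -> trace_form x u = 0).
Proof.
have lfT u : linfun (fun x : VF => trace_form x u) x = trace_form x u.
  pose lT := GRing.isLinear.Build _ _ _ _ _ (trace_form_is_linear u).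
  pose T : {linear VF -> L} := HB.pack (fun x : VF => trace_form x u) lT.
  exact: (lfunE T).
rewrite memvE; split=> [/subv_bigcapP sxU u Uu | xU].
  by move: (sxU u Uu); rewrite -memvE memv_ker lfT => /eqP.
by apply/subv_bigcapP=> u Uu; rewrite -memvE memv_ker lfT xU.
Qed.

End Forms.
End Spaces.

(* an element of the direct sum of the L^(n i) is a block row vector x, whose i-th
   component is submxrow x i *)
Notation code L n := {vspace 'rV[L]_(\sum_i n i)}.

Section Codes.
Variables (F : finFieldType) (L : splittingFieldType F).

Definition rk n (v : 'rV[L]_n) : nat := \dim <<[seq v 0%R j | j : 'I_n]>>%VS.

Definition rank_list t (n : 'I_t -> nat) (x : 'rV[L]_(\sum_i n i)) (i : 'I_t) :
  nat := rk (submxrow x i).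

Section Association.
Variables (k t : nat).

Definition Fcol n (G : 'M[L]_(k, n)) (j : 'I_n) : Fvec L k := [ffun r => G r j].

Definition generated_code N (G : 'M[L]_(k, N)) : {vspace 'rV[L]_N} :=
  <<[seq row r G | r : 'I_k]>>%VS.

Definition spanning (V : t.-tuple {vspace Fvec L k}) : Prop :=
  (\sum_i Lspan (tnth V i))%VS = fullv.

Definition associated (V : t.-tuple {vspace Fvec L k}) (n : 'I_t -> nat)
    (C : code L n) : Prop :=
  spanning V /\
  exists G : forall i, 'M[L]_(k, n i),
    (forall i, basis_of (tnth V i) [seq Fcol (G i) j | j : 'I_(n i)]) /\
    C = generated_code (\mxrow_i G i).

(* D is a geometric dual of a code associated with U, including the conditions
   under which this dual is defined *)
Definition geometric_dual (theta : {rmorphism L -> L})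
    (sigma : {bilinear Lvec L k -> Lvec L k -> L | *%R & theta \; *%R})
    (U : t.-tuple {vspace Fvec L k}) (n : 'I_t -> nat) (D : code L n) : Prop :=
  [/\ spanning U,
      ~ (exists P : {vspace Lvec L k},
           \dim P = 1%N /\ (restr P <= \bigcap_i tnth U i)%VS)
    & associated (map_tuple (perp sigma) U) D].

End Association.

Section Minimality.
Variables (m : nat) (b : m.-tuple L).

Definition Gamma n (x : 'rV[L]_n) : 'M[F]_(n, m) :=
  \matrix_(j, l) coord b l (x 0 j).

(* inclusion of column spaces is inclusion of the row spaces of transposes *)
Definition support_sub t (n : 'I_t -> nat) (c' c : 'rV[L]_(\sum_i n i)) : Prop :=
  forall i, ((Gamma (submxrow c' i))^T <= (Gamma (submxrow c i))^T)%MS.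

Definition minimal_code t (n : 'I_t -> nat) (C : code L n) : Prop :=
  forall c c', c \in C -> c' \in C -> support_sub c' c ->
    exists a : L, c' = a *: c.

End Minimality.

Section ABCondition.
Variables (t : nat) (n : 'I_t -> nat).

Definition AB_weight (r : 'I_t -> nat) : rat :=
  \sum_i ((#|F| ^ n i)%:R - (#|F| ^ (n i - r i))%:R) / (#|F|%:R - 1).

Definition AB_max (C : code L n) (d : rat) : Prop :=
  (exists c, [/\ c \in C, c != 0 & d = AB_weight (rank_list c)]) /\
  (forall c, c \in C -> c != 0 -> AB_weight (rank_list c) <= d).

Definition AB_min (C : code L n) (d : rat) : Prop :=
  (exists c, [/\ c \in C, c != 0 & d = AB_weight (rank_list c)]) /\
  (forall c, c \in C -> c != 0 -> d <= AB_weight (rank_list c)).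

Definition AB_condition (C : code L n) : Prop :=
  exists dmax dmin : rat,
    [/\ AB_max C dmax, AB_min C dmin
      & dmax / dmin <
          (#|F| ^ \dim {:L})%:R / ((#|F| ^ \dim {:L})%:R - 1)].

End ABCondition.
End Codes.

(* Main.v *)
(* Every linear functional on [L^3] is [sigma _ p] for a vector [p], so the words
   of the dual code are indexed by [p], and the block with columns a basis of
   [U_i^perp'] yields the word [j |-> sigma (g_j, p)].  As
   [U^perp' :&: <p>^perp = (U + <p>)^perp'], counting dimensions shows that its rank
   is [m - dim (U_i :&: <p>)], and taking orthogonals shows that the support of the
   word of [p'] lies in that of [p] iff [<p'> <= U_i + <p>] for all [i].

   If [p'] is not in [<p>], such an inclusion makes [U_i + <p>] the plane
   [<p, p'>]; as [U_i] spans [W_i], this plane is [W_i], which is impossible for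
   both [i = 1, 2].  For a single [U], a point [p] of [W] off [L_U] gives
   [U + <p> = W], so the code is not minimal.  Since [L_U1] and [L_U2] are disjoint
   and lie on two lines, the rank-lists are [(m, m)], [(m-1, m)] and
   [(m, m-1)], which reduces the AB-condition to an inequality in [q] and [m]. *)
Require Import Defs.
From HB Require Import structures.
From mathcomp Require Import all_boot all_order all_algebra all_fingroup all_field.
From mathcomp Require Import sesquilinear zify ring lra.

Set Implicit Arguments.
Unset Strict Implicit.
Unset Printing Implicit Defensive.

Import Order.TTheory GRing.Theory Num.Theory.
Local Open Scope ring_scope.

(** * Restriction of scalars from [L] to [F] *)

Section RestrictionOfScalars.
Variables (F : finFieldType) (L : splittingFieldType F) (k : nat).
Local Notation VF := (Fvec L k).
Local Notation VL := (Lvec L k).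

Lemma dim_Fvec : \dim {:VF} = (k * \dim {:L})%N.
Proof. by rewrite !dimvf /= /dim /= card_ord. Qed.

Lemma dim_Lvec : \dim {:VL} = k.
Proof. by rewrite dimvf /= /dim /= card_ord muln1. Qed.

(** The [F]-linear map [l |-> l *: p] is injective on [L], and its image is the point [<p>]. *)
Lemma dim_restr_line (p : VL) : p != 0 -> \dim (restr <[p]>) = \dim {:L}.
Proof.
move=> p_nz; pose f (l : L) : VF := l *: p.
have f_lin : linear f by move=> a x y; rewrite /f scalerDl Fscale_Lscale scalerA mulr_algl.
pose lf := GRing.isLinear.Build _ _ _ _ _ f_lin.
pose g : {linear L -> VF} := HB.pack f lf.
have lfT l : linfun g l = l *: p by rewrite lfunE.
have -> : restr <[p]> = (linfun g @: {:L})%VS.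
  apply/vspaceP=> u; rewrite mem_restr.
  apply/vlineP/memv_imgP=> [[l ->]|[l _ ->]]; exists l; rewrite ?memvf ?lfT //.
apply: limg_dim_eq; apply/eqP; rewrite -subv0; apply/subvP=> l.
rewrite memv_cap memvf memv_ker lfT memv0 => lp0.
have : l *: p == 0 := lp0; by rewrite scaler_eq0 (negPf p_nz) orbF.
Qed.

Lemma restrD (W1 W2 : {vspace VL}) : restr (W1 + W2) = (restr W1 + restr W2)%VS.
Proof.
apply/vspaceP=> u; rewrite mem_restr.
apply/memv_addP/memv_addP=> [] [x Wx [y Wy ->]]; exists x; rewrite ?mem_restr // in Wx *;
  by exists y; rewrite ?mem_restr // in Wy *.
Qed.

Lemma sub_restr (W1 W2 : {vspace VL}) :
  (W1 <= W2)%VS -> (restr W1 <= restr W2)%VS.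
Proof. by move=> sW; apply/subvP=> u; rewrite !mem_restr => /(subvP sW). Qed.

Lemma Lspan_sub (U : {vspace VF}) (H : {vspace VL}) :
  (Lspan U <= H)%VS = (U <= restr H)%VS.
Proof.
apply/idP/subvP=> [/LspanP sU u /sU|sU]; first by rewrite mem_restr.
by apply/LspanP=> u /sU; rewrite mem_restr.
Qed.
End RestrictionOfScalars.

(** * Orthogonal complements for the trace form *)

Section TraceForm.
Variables (F : finFieldType) (L : splittingFieldType F) (k : nat).
Local Notation VF := (Fvec L k).
Local Notation VL := (Lvec L k).
Variable theta : {rmorphism L -> L}.
Variable sigma : {bilinear VL -> VL -> L | *%R & theta \; *%R}.
Hypothesis sigma_refl : reflexive_form sigma.
Hypothesis sigma_nondeg : nondegenerate_form sigma.
Implicit Types (U : {vspace VF}) (W : {vspace VL}).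

(** A field endomorphism is injective, and [L] is finite. *)
Lemma rmorph_surj (y : L) : exists x, theta x = y.
Proof.
have [g _ gK] :=
  injF_bij (fmorph_inj theta : injective (theta : finvect_type L -> finvect_type L)).
by exists (g y); apply: gK.
Qed.

(* F embeds in L as the set of roots of X^#|F| - X, which every ring
   endomorphism of L preserves. *)
Lemma rmorph_scalar (a : F) : exists a' : F, theta a%:A = a'%:A.
Proof.
apply/vlineP; rewrite -[<[1]>%VS]/(1%AS : {vspace L}) Fermat's_little_theorem.
have: (a%:A : L) \in 1%AS by rewrite rpredZ ?mem1v.
by rewrite Fermat's_little_theorem -rmorphXn => /eqP->.
Qed.

Lemma galTrace_scalar (x : L) : galTrace 1 {:L} x \in 1%VS.
Proof. exact: mem_galTrace (finField_galois (sub1v _)) (memvf x). Qed.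

(** Distinct automorphisms are linearly independent; this is applied to their sum, with all
    coefficients equal to 1. *)
Lemma galTrace_neq0 : exists x : L, galTrace 1 {:L} x != 0.
Proof.
have [x _ trx] := @gal_independent_contra _ _ {:L}%AS (mem 'Gal({:L} / 1)%g) (fun=> 1) _
  (group1 _) (oner_neq0 _).
exists x; apply: contraNneq trx => tr0; apply/eqP; rewrite -[RHS]tr0.
by apply: eq_bigr => g _; rewrite mul1r.
Qed.

Lemma sigmaZr (a : L) (x y : VL) : sigma x (a *: y) = theta a * sigma x y.
Proof. exact: linearZr_LR. Qed.

Lemma trace_formDr (x u v : VF) :
  trace_form sigma x (u + v) = trace_form sigma x u + trace_form sigma x v.
Proof. by rewrite /trace_form (linearDr sigma x u v) raddfD. Qed.

Lemma trace_formZr (a : F) (x u : VF) :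
  exists a' : F, trace_form sigma x (a *: u) = a' *: trace_form sigma x u.
Proof.
have [a' ta] := rmorph_scalar a; exists a'.
rewrite /trace_form Fscale_Lscale sigmaZr ta mulr_algl /galTrace scaler_sumr.
by apply: eq_bigr => g _; rewrite linearZ.
Qed.

Lemma mem_perp_restr W (x : VF) :
  x \in perp sigma (restr W) <-> (forall w : VL, w \in W -> sigma x w = 0).
Proof.
split=> [/perpP xW w Ww | xW]; last first.
  by apply/perpP=> u; rewrite mem_restr /trace_form => /xW->; rewrite raddf0.
apply/eqP; apply: contraT => xw_nz; have [t] := galTrace_neq0.
(* This choice of [l] makes [sigma x (l *: w)] equal to [t], whose trace is nonzero. *)
have [l tl] := rmorph_surj (t / sigma x w).
have := xW (l *: w); rewrite mem_restr memvZ // /trace_form sigmaZr tl divfK //.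
by move=> ->; rewrite ?eqxx.
Qed.

Lemma mem_perp_line (p : VL) (x : VF) :
  x \in perp sigma (restr <[p]>) <-> sigma x p = 0.
Proof.
split=> [/mem_perp_restr|xp]; first by apply; apply: memv_line.
apply/mem_perp_restr=> w /vlineP[l ->].
by rewrite sigmaZr xp mulr0.
Qed.

Lemma perpD U1 U2 : perp sigma (U1 + U2) = (perp sigma U1 :&: perp sigma U2)%VS.
Proof.
apply/vspaceP=> x; rewrite memv_cap; apply/idP/andP=> [/perpP xU|[/perpP x1 /perpP x2]].
  split; apply/perpP=> u Uu; apply: xU; first exact: (subvP (addvSl _ _)).
  exact: (subvP (addvSr _ _)).
apply/perpP=> _ /memv_addP[u Uu [v Uv ->]].
by rewrite trace_formDr x1 ?x2 ?addr0.
Qed.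

Lemma perpS U1 U2 : (U1 <= U2)%VS -> (perp sigma U2 <= perp sigma U1)%VS.
Proof.
move=> sU; apply/subvP=> x /perpP xU; apply/perpP=> u /(subvP sU); exact: xU.
Qed.

Lemma perp0 : perp sigma 0 = fullv.
Proof.
apply/vspaceP=> x; rewrite memvf; apply/perpP=> u; rewrite memv0 => /eqP->.
by rewrite /trace_form (linear0r sigma x) raddf0.
Qed.

Lemma perpf : perp sigma fullv = 0%VS.
Proof.
apply/eqP; rewrite -subv0; apply/subvP=> x /perpP xU; rewrite memv0; apply/eqP.
apply: sigma_nondeg => y; apply/(mem_perp_line y); apply/perpP=> u _.
exact/xU/memvf.
Qed.

(** Pairing with [u] maps [perp sigma U] into the one-dimensional space [1%VS], and its kernel is
    orthogonal to [u] as well. *)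
Lemma dim_perp_line U (u : VF) :
  (\dim (perp sigma U) <= \dim (perp sigma (U + <[u]>)) + 1)%N.
Proof.
pose lf := GRing.isLinear.Build _ _ _ _ _ (trace_form_is_linear sigma u).
pose g : {linear VF -> L} := HB.pack (fun x : VF => trace_form sigma x u) lf.
have gE x : linfun g x = trace_form sigma x u by rewrite lfunE.
rewrite -(limg_ker_dim (linfun g) (perp sigma U)) leq_add //; last first.
  apply: leq_trans (dimvS (_ : _ <= 1%VS)%VS) _; last by rewrite dimv1.
  by apply/subvP=> _ /memv_imgP[x _ ->]; rewrite gE galTrace_scalar.
apply: dimvS; rewrite perpD capvS //; apply/subvP=> x; rewrite memv_ker gE => /eqP xu.
apply/perpP=> _ /vlineP[a ->]; have [a' ->] := trace_formZr a x u.
by rewrite xu scaler0.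
Qed.

Lemma dim_perpD U1 U2 :
  (\dim (perp sigma U1) <= \dim (perp sigma (U1 + U2)) + \dim U2)%N.
Proof.
have [X sX defU2] : exists2 X, size X = \dim U2 & U2 = <<X>>%VS.
  by exists (vbasis U2); rewrite ?size_tuple ?(span_basis (vbasisP U2)).
rewrite -sX defU2; elim: X U1 {sX defU2} => [|u X IHX] U1; first by rewrite span_nil addv0 addn0.
rewrite span_cons addvA /= addnS -addn1.
exact: leq_trans (dim_perp_line U1 u) (leq_add (IHX _) (leqnn _)).
Qed.

(** Both inequalities come from [dim_perpD]: enlarging 0 to [U] gives the lower bound, and enlarging
    [U] to the whole space by a complement gives the upper one. *)
Lemma dim_perp U : (\dim (perp sigma U) + \dim U)%N = (k * \dim {:L})%N.
Proof.
apply/eqP; rewrite eqn_leq -dim_Fvec; apply/andP; split; last first.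
  by have := dim_perpD 0 U; rewrite perp0 add0v.
have := dim_perpD U U^C; rewrite addv_complf perpf dimv0 add0n => le_compl.
rewrite -(addv_complf U) dimv_disjoint_sum ?capv_compl // addnC leq_add2l.
exact: le_compl.
Qed.

(** The hypothesis gives [U1] and [U1 + U2] the same complement, hence the same dimension. This
    avoids double complements, so the trace form need not be reflexive. *)
Lemma sub_perp U1 U2 : (perp sigma U1 <= perp sigma U2)%VS -> (U2 <= U1)%VS.
Proof.
move=> sP; suff /eqP defU1 : U1 == (U1 + U2)%VS by rewrite defU1 addvSr.
rewrite eqEdim addvSl -(leq_add2l (\dim (perp sigma (U1 + U2)))) dim_perp.
by rewrite perpD (capv_idPl sP) dim_perp /=.
Qed.

Lemma sigma_coord (x p : VL) :
  sigma x p = \sum_i x i * sigma [ffun j => (j == i)%:R] p.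
Proof.
have {1}-> : x = \sum_i (x i : L) *: ([ffun j => (j == i)%:R] : VL).
  apply/ffunP=> j; rewrite sum_ffunE (bigD1 j) //= !ffunE eqxx [X in X + _]mulr1.
  by rewrite big1 ?addr0 // => i ij; rewrite !ffunE eq_sym (negPf ij) [LHS]mulr0.
by rewrite linear_sumlz; apply: eq_bigr => i _; apply: linearZl_LR.
Qed.

(** Sending [p] to the coordinates of the functional [sigma _ p] is an injective self-map of a
    finite set. Reflexivity carries nondegeneracy over to the second argument. *)
Lemma sigma_surj (a : 'I_k -> L) :
  exists p : VL, forall x : VL, sigma x p = \sum_i x i * a i.
Proof.
pose f (p : finvect_type VF) : finvect_type VF :=
  [ffun i => sigma [ffun j => (j == i)%:R] p].
have f_inj : injective f.
  move=> p1 p2 /ffunP f12; apply/eqP; rewrite -subr_eq0; apply/eqP.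
  apply: sigma_nondeg => y; apply: sigma_refl; rewrite sigma_coord big1 // => i _.
  by have := f12 i; rewrite !ffunE (linearBr sigma) => ->; rewrite subrr mulr0.
have [g _ gK] := injF_bij f_inj.
exists (g [ffun i => a i]) => x; rewrite sigma_coord; apply: eq_bigr => i _.
by have /ffunP/(_ i) := gK [ffun i => a i]; rewrite !ffunE => ->.
Qed.

(** If the span were proper, some nonzero [p] would be orthogonal to all of [perp sigma U], and
    [sub_perp] would place [<p>] inside [U]. *)
Lemma Lspan_perp U :
  (forall p : VL, p != 0 -> ~~ (restr <[p]> <= U)%VS) ->
  Lspan (perp sigma U) = fullv.
Proof.
move=> noL; set X := perp sigma U; apply/eqP; apply: contraT => X_nfull.
have: perp sigma (restr (Lspan X)) != 0%VS.
  apply: contraNneq X_nfull => perpX0; rewrite eqEsubv subvf.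
  have: (\dim {:VF} <= \dim (restr (Lspan X)))%N.
    by have := dim_perp (restr (Lspan X)); rewrite perpX0 dimv0 dim_Fvec => <-.
  rewrite (geq_leqif (dimv_leqif_sup (subvf _))) => /subvP fX; apply/subvP=> x _.
  by have := fX x (memvf _); rewrite mem_restr.
rewrite -vpick0; set p := vpick _ => p_nz.
have p_perp: p \in perp sigma (restr (Lspan X)) by apply: memv_pick.
have /negP[] := noL p p_nz; apply: sub_perp; apply/subvP=> x Xx.
apply/mem_perp_line; apply: sigma_refl; apply: (mem_perp_restr _ _).1 p_perp _ _.
by rewrite -mem_restr; move: x Xx; apply/subvP; rewrite -Lspan_sub.
Qed.
End TraceForm.

(** * Points, planes and scattered subspaces *)

Section ScatteredSubspaces.
Variables (F : finFieldType) (L : splittingFieldType F) (k : nat).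
Local Notation VF := (Fvec L k).
Local Notation VL := (Lvec L k).
Local Notation m := (\dim {:L}).
Implicit Types (U : {vspace VF}) (W : {vspace VL}) (p : VL).

Lemma cap_restr_lines p p' : p' \notin <[p]>%VS -> (restr <[p]> :&: restr <[p']> = 0)%VS.
Proof.
move=> p'Np; apply/eqP; rewrite -subv0; apply/subvP=> u.
rewrite memv_cap !mem_restr => /andP[/vlineP[a ua] /vlineP[b ub]].
have [b0|b_nz] := eqVneq b 0; first by rewrite ub b0 scale0r mem0v.
case/negP: p'Np; apply/vlineP; exists (b^-1 * a).
by rewrite -scalerA -ua ub scalerA mulVf // scale1r.
Qed.

Lemma dim_add_lines p p' :
  p != 0 -> p' \notin <[p]>%VS -> \dim (<[p]> + <[p']>)%VS = 2%N.
Proof.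
move=> p_nz p'Np; have p'_nz: p' != 0 by apply: contraNneq p'Np => ->; apply: mem0v.
rewrite dimv_disjoint_sum ?dim_vline ?p_nz ?p'_nz //.
apply/eqP; rewrite -subv0; apply/subvP=> x; rewrite memv_cap => /andP[xp xp'].
have /vspaceP/(_ x) := cap_restr_lines p'Np.
by rewrite memv_cap !mem_restr xp xp' => /esym; rewrite !memv0.
Qed.

(** A plane is the direct sum of two points, each of [F]-dimension [m]. *)
Lemma dim_restr_plane W : \dim W = 2%N -> \dim (restr W) = (2 * m)%N.
Proof.
move=> dimW; have /subvPn[p' Wp' p'Np] : ~~ (W <= <[vpick W]>)%VS.
  by apply: contraTN isT => /dimvS; rewrite dimW dim_vline; case: eqP.
have p_nz: vpick W != 0 by rewrite vpick0 -dimv_eq0 dimW.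
have p'_nz: p' != 0 by apply: contraNneq p'Np => ->; apply: mem0v.
have <- : (<[vpick W]> + <[p']>)%VS = W.
  apply/eqP; rewrite eqEdim subv_add -!memvE memv_pick Wp' dimW /=.
  by rewrite dim_add_lines.
by rewrite restrD dimv_disjoint_sum ?cap_restr_lines // !dim_restr_line ?mul2n ?addnn.
Qed.

Lemma scattered_no_line U p :
  (1 < m)%N -> scattered U -> p != 0 -> ~~ (restr <[p]> <= U)%VS.
Proof.
move=> m_gt1 scU p_nz; apply: contraTN m_gt1 => /capv_idPr sU.
by rewrite -leqNgt -(dim_restr_line p_nz) -sU scU.
Qed.

(** Otherwise [U] is zero or lies in a single point, where a scattered subspace has dimension at
    most 1. *)
Lemma dim_Lspan_scattered U : scattered U -> (1 < \dim U)%N -> (1 < \dim (Lspan U))%N.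
Proof.
move=> scU dimU; rewrite ltnNge; apply/negP=> dimS.
have [U0|v_nz] := eqVneq (vpick (Lspan U)) 0.
  have /dimvS : (U <= 0)%VS.
    move/eqP: U0; rewrite vpick0 => /eqP U0; apply/subvP=> u Uu.
    have /LspanP/(_ u Uu) : (Lspan U <= 0)%VS by rewrite U0.
    by rewrite !memv0.
  by rewrite dimv0 leqNgt (leq_trans _ dimU).
have defS : <[vpick (Lspan U)]>%VS = Lspan U.
  by apply/eqP; rewrite eqEdim -memvE memv_pick dim_vline v_nz.
have sU : (U <= restr <[vpick (Lspan U)]>)%VS by rewrite -Lspan_sub defS.
by have := scU _ v_nz; rewrite (capv_idPl sU) leqNgt dimU.
Qed.

Lemma Lspan_scattered U W :
  scattered U -> (1 < \dim U)%N -> \dim W = 2%N -> (U <= restr W)%VS -> Lspan U = W.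
Proof.
move=> scU dimU dimW sUW; apply/eqP.
by rewrite eqEdim Lspan_sub sUW dimW dim_Lspan_scattered.
Qed.

(* If [p] and [p'] were distinct points, then [U + <p>] would have the dimension
   of the plane they span, forcing [U] to lie in that plane. *)
Lemma sub_plane_of_line U p p' :
    (1 < m)%N -> scattered U -> \dim U = m ->
    p' \notin <[p]>%VS -> (restr <[p']> <= U + restr <[p]>)%VS ->
  (U <= restr (<[p]> + <[p']>))%VS /\ \dim (<[p]> + <[p']>)%VS = 2%N.
Proof.
move=> m_gt1 scU dimU p'Np sp'.
have p'_nz: p' != 0 by apply: contraNneq p'Np => ->; apply: mem0v.
(* If [p] were 0, [U] itself would contain the whole point [<p'>], against scatteredness. *)
have p_nz: p != 0.
  apply: contraTneq sp' => ->; suff -> : restr <[0]> = (0%VS : {vspace VF}).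
    by rewrite addv0; apply: scattered_no_line.
  apply/eqP; rewrite -subv0; apply/subvP=> u; rewrite mem_restr => /vlineP[l ->].
  by rewrite scaler0 mem0v.
rewrite dim_add_lines //; split=> //.
have sPU: (restr <[p]> + restr <[p']> <= U + restr <[p]>)%VS by rewrite subv_add addvSr.
rewrite restrD; suff /eqP-> : (restr <[p]> + restr <[p']> == U + restr <[p]>)%VS.
  exact: addvSl.
rewrite eqEdim sPU (dimv_disjoint_sum (cap_restr_lines p'Np)) !dim_restr_line //.
by rewrite -{1}dimU -{1}(dim_restr_line p_nz) dimv_add_leqif.
Qed.

(** For distinct points [<p>] and [<p'>], both [U1] and [U2] would lie in the plane they span, which
    would then equal both [W1] and [W2]. *)
Lemma scattered_planes_line U1 U2 W1 W2 p p' :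
    (1 < m)%N -> \dim W1 = 2%N -> \dim W2 = 2%N -> W1 != W2 ->
    scattered U1 -> scattered U2 -> \dim U1 = m -> \dim U2 = m ->
    (U1 <= restr W1)%VS -> (U2 <= restr W2)%VS ->
    (restr <[p']> <= U1 + restr <[p]>)%VS ->
    (restr <[p']> <= U2 + restr <[p]>)%VS ->
  p' \in <[p]>%VS.
Proof.
move=> m_gt1 dimW1 dimW2 W12 sc1 sc2 dim1 dim2 sU1 sU2 sp1 sp2.
apply: contraNT W12 => p'Np.
have [sP1 dimP] := sub_plane_of_line m_gt1 sc1 dim1 p'Np sp1.
have [sP2 _] := sub_plane_of_line m_gt1 sc2 dim2 p'Np sp2.
rewrite -(Lspan_scattered sc1 _ dimW1 sU1) ?dim1 //.
rewrite -(Lspan_scattered sc2 _ dimW2 sU2) ?dim2 //.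
by rewrite (Lspan_scattered sc1 _ dimP sP1) ?dim1 // (Lspan_scattered sc2 _ dimP sP2) ?dim2.
Qed.

(* There are at most [(q^m - 1) q^m < q^(2m)] vectors [l *: u] with [l != 0] and
   [u] in [U], so they do not exhaust [W]. *)
Lemma exists_disjoint_line U W :
    \dim W = 2%N -> \dim U = m ->
  exists p, [/\ p \in W, p != 0 & (U :&: restr <[p]> = 0)%VS].
Proof.
move=> dimW dimU.
pose S := [set ((x.1 : L) *: (x.2 : VL) : finvect_type VF)
  | x : finvect_type L * finvect_type VF in setX [set~ 0] [set u in (U : {vspace (finvect_type VF)})]].
have cardS: (#|S| < #|(restr W : {vspace (finvect_type VF)})|)%N.
  apply: leq_ltn_trans (leq_imset_card _ _) _.
  rewrite cardsX cardsC1 cardsE [X in (_ * X < _)%N]card_vspace card_vspace.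
  have -> : #|finvect_type L| = (#|F| ^ m)%N.
    rewrite -(card_vspace (fullv : {vspace (finvect_type L)})).
    by apply: eq_card => l; rewrite memvf.
  rewrite dimU dim_restr_plane //.
  have q_gt0 : (0 < #|F| ^ m)%N by rewrite expn_gt0 ltnW ?finNzRing_gt1.
  by rewrite mul2n -addnn expnD ltn_pmul2r // prednK.
have /subsetPn[p Wp pNS] : ~~ ((restr W : {vspace (finvect_type VF)}) \subset S).
  by apply: contraL cardS => /subset_leq_card; rewrite leqNgt.
have US l (u : VF) : l != 0 -> u \in U -> (l *: (u : VL) : finvect_type VF) \in S.
  by move=> l_nz Uu; apply/imsetP; exists (l, u); rewrite // !inE l_nz.
exists p; split; first by rewrite -mem_restr.
  by apply: contraNneq pNS => ->; rewrite -(scale1r (0 : VL)) US ?oner_neq0 ?mem0v.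
apply/eqP; rewrite -subv0; apply/subvP=> u; rewrite memv_cap mem_restr => /andP[Uu].
case/vlineP=> l ul; have [l0|l_nz] := eqVneq l 0; first by rewrite ul l0 scale0r mem0v.
(* A nonzero vector of [U] on [<p>] would exhibit [p] as an element of [S]. *)
have defp: p = l^-1 *: (u : VL) by rewrite ul; rewrite scalerA mulVf // scale1r.
by case/negP: pNS; rewrite defp US ?invr_neq0.
Qed.

(** For a point [<p>] of [W] missing [U], the two spaces are independent of dimension [m] and
    together fill [W]; any [p'] of [W] off [<p>] then serves. *)
Lemma exists_line_in_sum U W :
    \dim W = 2%N -> \dim U = m -> (U <= restr W)%VS ->
  exists p p', p' \notin <[p]>%VS /\ (restr <[p']> <= U + restr <[p]>)%VS.
Proof.
move=> dimW dimU sUW; have [p [Wp p_nz Up]] := exists_disjoint_line dimW dimU.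
have /subvPn[p' Wp' p'Np] : ~~ (W <= <[p]>)%VS.
  by apply: contraTN isT => /dimvS; rewrite dimW dim_vline; case: eqP.
exists p, p'; split=> //; apply: subv_trans (sub_restr (_ : _ <= W)%VS) _ => //.
suff /eqP-> : (U + restr <[p]> == restr W)%VS by [].
rewrite eqEdim subv_add sUW sub_restr -?memvE // dimv_disjoint_sum //.
by rewrite dim_restr_plane // dim_restr_line // dimU mul2n addnn /=.
Qed.

(** A vector of [W1] off [W2] plus a vector of [W2] off [W1] lies in neither plane. Such a point
    realizes the rank-list [(m, m)]. *)
Lemma exists_line_off_planes U1 U2 W1 W2 :
    \dim W1 = 2%N -> \dim W2 = 2%N -> W1 != W2 ->
    (U1 <= restr W1)%VS -> (U2 <= restr W2)%VS ->
  exists p, [/\ p != 0, (U1 :&: restr <[p]> = 0)%VS & (U2 :&: restr <[p]> = 0)%VS].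
Proof.
move=> dimW1 dimW2 W12 sU1 sU2.
have /subvPn[w1 W1w1 W2w1] : ~~ (W1 <= W2)%VS.
  by apply: contraNN W12 => sW; rewrite eqEdim sW dimW1 dimW2.
have /subvPn[w2 W2w2 W1w2] : ~~ (W2 <= W1)%VS.
  by apply: contraNN W12 => sW; rewrite eq_sym eqEdim sW dimW1 dimW2.
have W1p: w1 + w2 \notin W1 by rewrite rpredDl.
have W2p: w1 + w2 \notin W2 by rewrite rpredDr.
have cap0 U W p : (U <= restr W)%VS -> p \notin W -> (U :&: restr <[p]> = 0)%VS.
  move=> sUW Wp; apply/eqP; rewrite -subv0; apply/subvP=> u.
  rewrite memv_cap mem_restr => /andP[/(subvP sUW)]; rewrite mem_restr => Wu.
  case/vlineP=> l ul; have [l0|l_nz] := eqVneq l 0; first by rewrite ul l0 scale0r mem0v.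
  by case/negP: Wp; rewrite -[p](scalerK l_nz) -ul memvZ.
exists (w1 + w2); split; [|exact: cap0 sU1 _|exact: cap0 sU2 _].
by apply: contraNneq W1p => ->; apply: mem0v.
Qed.

(** A subspace meeting [<p>] nontrivially has [<p>] in its linear set, so two such subspaces would
    share this point. *)
Lemma cap_disjoint_linear_sets U1 U2 p :
    disjoint_linear_sets U1 U2 -> p != 0 ->
  (U1 :&: restr <[p]> = 0)%VS \/ (U2 :&: restr <[p]> = 0)%VS.
Proof.
move=> disU p_nz; have point U : (U :&: restr <[p]> != 0)%VS -> linear_set U <[p]>%VS.
  rewrite -vpick0; set u := vpick _ => u_nz.
  have := memv_pick (U :&: restr <[p]>)%VS; rewrite -/u memv_cap mem_restr => /andP[Uu pu].
  exists u; split=> //; apply/eqP; rewrite eq_sym eqEdim -memvE pu !dim_vline p_nz.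
  by rewrite (_ : (u : VL) != 0).
have [->|U1p] := eqVneq (U1 :&: restr <[p]>)%VS 0%VS; [by left | right].
have [//|U2p] := eqVneq (U2 :&: restr <[p]>)%VS 0%VS.
by case: (disU <[p]>%VS); split; apply: point.
Qed.
End ScatteredSubspaces.

(** * Associated codes and generator matrices *)

Lemma associated_exists (F : finFieldType) (L : splittingFieldType F) (k t : nat)
    (V : t.-tuple {vspace Fvec L k}) :
  spanning V -> exists (n : 'I_t -> nat) (C : code L n), associated V C.
Proof.
move=> spV; exists (fun i => \dim (tnth V i)).
pose G i : 'M[L]_(k, \dim (tnth V i)) := \matrix_(r, j) (tnth (vbasis (tnth V i)) j) r.
exists (generated_code (\mxrow_i G i)); split=> //; exists G; split=> // i.
rewrite (_ : [seq _ | _ : _] = vbasis (tnth V i)) ?vbasisP //.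
rewrite -[RHS]map_tnth_enum; apply: eq_map => j.
by apply/ffunP=> r; rewrite !ffunE mxE.
Qed.

Lemma mem_generated_code (F : finFieldType) (L : splittingFieldType F) (k N : nat)
    (G : 'M[L]_(k, N)) (c : 'rV[L]_N) :
  c \in generated_code G <-> exists a : 'rV[L]_k, c = a *m G.
Proof.
split=> [Cc|[a ->]].
  have /subvP sC : (generated_code G <= limg (linfun (mulmxr G : 'rV_k -> 'rV_N)))%VS.
    apply/span_subvP=> _ /codomP[r ->].
    by apply/memv_imgP; exists (delta_mx 0 r); rewrite ?memvf // lfunE /= -rowE.
  by have /memv_imgP[a _ ->] := sC c Cc; exists a; rewrite lfunE.
rewrite mulmx_sum_row memv_suml // => r _; rewrite memvZ //.
by rewrite memv_span //; apply/codomP; exists r.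
Qed.

(** * Words of the dual code: ranks, supports and minimality *)

Section DualCodewords.
Variables (F : finFieldType) (L : splittingFieldType F) (k : nat).
Local Notation VF := (Fvec L k).
Local Notation VL := (Lvec L k).
Local Notation m := (\dim {:L}).
Variable theta : {rmorphism L -> L}.
Variable sigma : {bilinear VL -> VL -> L | *%R & theta \; *%R}.
Hypothesis sigma_refl : reflexive_form sigma.
Hypothesis sigma_nondeg : nondegenerate_form sigma.
Implicit Types (U : {vspace VF}) (p : VL).

(* Every linear functional on L^k is [sigma _ p] for some [p], so these are the
   words [a *m G]. *)
Definition form_word n (G : 'M[L]_(k, n)) p : 'rV[L]_n := \row_j sigma (Fcol G j) p.

Lemma sigma_Flinear p : linear (fun x : VF => sigma x p : L).
Proof.
move=> a u v; rewrite (_ : sigma _ _ = sigma ((a%:A : L) *: (u : VL) + v) p).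
  by rewrite linearPl /= mulr_algl.
by congr (sigma _ _); rewrite -Fscale_Lscale.
Qed.

Definition sigma_at p : {linear VF -> L} :=
  HB.pack (fun x : VF => sigma x p : L)
    (GRing.isLinear.Build _ _ _ _ _ (sigma_Flinear p)).

Section Block.
Variables (n : nat) (G : 'M[L]_(k, n)) (U : {vspace VF}).
Hypothesis basisG : basis_of (perp sigma U) [seq Fcol G j | j : 'I_n].

Lemma block_length : (n + \dim U)%N = (k * m)%N.
Proof.
rewrite -(dim_perp sigma_nondeg U) -(span_basis basisG).
by rewrite (eqP (basis_free basisG)) size_map size_enum_ord.
Qed.

(** Rank-nullity for [sigma _ p] on [perp sigma U]: the entries of the word span the image, and the
    kernel is the complement of [U + <p>]. *)
Lemma rk_form_word p : p != 0 -> (rk (form_word G p) + \dim (U :&: restr <[p]>))%N = m.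
Proof.
move=> p_nz; pose f := linfun (sigma_at p).
have fE x : f x = sigma x p by rewrite lfunE.
have rkE : rk (form_word G p) = \dim (f @: perp sigma U).
  rewrite -(span_basis basisG) limg_span -map_comp /rk; congr (\dim <<_>>).
  by apply: eq_map => j; rewrite mxE /= fE.
have kerE : (perp sigma U :&: lker (f) = perp sigma (U + restr <[p]>))%VS.
  rewrite perpD; congr (_ :&: _)%VS; apply/vspaceP=> x; rewrite memv_ker fE.
  by apply/eqP/idP=> /mem_perp_line.
have := limg_ker_dim (f) (perp sigma U); rewrite kerE -rkE.
have := dimv_sum_cap U (restr <[p]>); rewrite dim_restr_line //.
have := dim_perp sigma_nondeg U; have := dim_perp sigma_nondeg (U + restr <[p]>).
move: (\dim _) (\dim _) (\dim _) (\dim _) => *; lia.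
Qed.

(** Both sides say that every vector of [perp sigma U] orthogonal to [p] is orthogonal to [p']: the
    matrix of a word kills the column [y] exactly when [comb y] is orthogonal to the vector indexing
    that word. *)
Lemma sub_line_form_word (b : m.-tuple L) p p' : basis_of {:L} b ->
  ((Gamma b (form_word G p'))^T <= (Gamma b (form_word G p))^T)%MS =
  (restr <[p']> <= U + restr <[p]>)%VS.
Proof.
move=> basis_b; pose comb (y : 'cV[F]_n) : VF := \sum_j y j 0 *: Fcol G j.
have GammaE p0 y : ((Gamma b (form_word G p0))^T *m y == 0) = (sigma (comb y) p0 == 0).
  have -> : sigma (comb y) p0 = \sum_l ((Gamma b (form_word G p0))^T *m y) l 0 *: b`_l.
    have sigma_comb : sigma (comb y) p0 = \sum_j y j 0 *: sigma (Fcol G j) p0.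
      rewrite [LHS](raddf_sum (sigma_at p0)); apply: eq_bigr => j _.
      exact: (linearZ_LR (sigma_at p0)).
    rewrite sigma_comb; under [RHS]eq_bigr => l _.
      rewrite mxE scaler_suml; under eq_bigr => j _ do rewrite !mxE mulrC -scalerA.
      over.
    rewrite exchange_big; apply: eq_bigr => j _ /=.
    by rewrite -scaler_sumr -(coord_basis basis_b (memvf _)).
  apply/eqP/eqP=> [->|s0]; first by rewrite big1 // => l _; rewrite mxE scale0r.
  have /freeP free_b := basis_free basis_b.
  by apply/colP=> l; rewrite [RHS]mxE; apply: free_b s0 l.
have combP (x : VF) : x \in perp sigma U -> exists y, x = comb y.
  rewrite -(span_basis basisG) => /(@coord_span _ _ _ (map_tuple _ (ord_tuple n)) _) ->.
  exists (\col_j coord (map_tuple (Fcol G) (ord_tuple n)) j x).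
  by apply: eq_bigr => j _; rewrite mxE -tnth_nth tnth_map tnth_ord_tuple.
apply/idP/idP=> [sG | sU].
  apply: (sub_perp sigma_nondeg); apply/subvP=> x; rewrite perpD memv_cap.
  case/andP=> /combP[y ->] /mem_perp_line/eqP; rewrite -GammaE => /eqP y0.
  apply/mem_perp_line/eqP; rewrite -GammaE; case/submxP: sG => D ->.
  by rewrite -mulmxA y0 mulmx0.
(* The matrix of [p] kills every column of [K]; the inclusion holds once the matrix of [p'] kills
   them too. *)
rewrite submxE; set K := cokermx _; apply/eqP/matrixP=> l j.
have combK : comb (col j K) \in perp sigma (U + restr <[p]>).
  rewrite perpD memv_cap; apply/andP; split.
    rewrite -(span_basis basisG) memv_suml // => i _.
    by rewrite memvZ // memv_span // map_f ?mem_enum.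
  by apply/mem_perp_line/eqP; rewrite -GammaE colE mulmxA mulmx_coker mul0mx.
have /(subvP (perpS _ sU))/mem_perp_line/eqP := combK.
by rewrite -GammaE colE mulmxA -colE => /eqP/colP/(_ l); rewrite !mxE.
Qed.
End Block.
Section Blocks.
Variables (t : nat) (U : t.-tuple {vspace VF}) (n : 'I_t -> nat).

Definition dual_word (G : forall i, 'M[L]_(k, n i)) p : 'rV[L]_(\sum_i n i) :=
  \mxrow_i form_word (G i) p.

Lemma dual_codewords (D : code L n) : associated (map_tuple (perp sigma) U) D ->
  exists G : forall i, 'M[L]_(k, n i),
    (forall i, basis_of (perp sigma (tnth U i)) [seq Fcol (G i) j | j : 'I_(n i)]) /\
    (forall c, c \in D <-> exists p, c = dual_word G p).
Proof.
case=> _ [G [basisG ->]]; exists G; split=> [i|c]; first by have := basisG i; rewrite tnth_map.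
have wordE (a : 'rV[L]_k) p : (forall x : VL, sigma x p = \sum_i x i * a 0 i) ->
    dual_word G p = a *m \mxrow_i G i.
  move=> ap; rewrite mul_mxrow; apply: eq_mxrow => i; apply/rowP=> j.
  by rewrite !mxE ap; apply: eq_bigr => r _; rewrite ffunE mulrC.
split=> [/mem_generated_code[a ->]|[p ->]].
  by have [p ap] := sigma_surj sigma_refl sigma_nondeg (a 0); exists p; rewrite (wordE a).
(* The coefficients are the values of [sigma _ p] on the standard basis. *)
apply/mem_generated_code; exists (\row_i sigma [ffun j => (j == i)%:R] p).
by apply: wordE => x; rewrite sigma_coord; apply: eq_bigr => i _; rewrite mxE.
Qed.

Variable G : forall i, 'M[L]_(k, n i).
Hypothesis basisG :
  forall i, basis_of (perp sigma (tnth U i)) [seq Fcol (G i) j | j : 'I_(n i)].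

Lemma dual_wordB p p' : dual_word G (p - p') = dual_word G p - dual_word G p'.
Proof. by apply/rowP=> j; rewrite !mxE (linearBr sigma). Qed.

Lemma dual_wordZ a p : dual_word G (a *: p) = theta a *: dual_word G p.
Proof. by apply/rowP=> j; rewrite !mxE sigmaZr. Qed.

(** A zero block puts the complement of [U_i] inside that of [<p>], and [sub_perp] reverses the
    inclusion. *)
Lemma dual_word_eq0 p i : dual_word G p = 0 -> (restr <[p]> <= tnth U i)%VS.
Proof.
move=> w0; apply: (sub_perp sigma_nondeg); rewrite -(span_basis (basisG i)).
apply/span_subvP=> _ /mapP[j _ ->]; apply/mem_perp_line.
have /rowP/(_ j) := congr1 (fun c => submxrow c i) w0.
by rewrite submxrow0 mxrowK !mxE.
Qed.

(** The word is [theta]-semilinear in the vector, [theta] is onto, and by the last hypothesis only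
    the zero vector gives the zero word; so words are proportional exactly when their vectors
    are. *)
Lemma minimal_dual_codeP (b : m.-tuple L) (D : code L n) :
    basis_of {:L} b ->
    (forall c, c \in D <-> exists p, c = dual_word G p) ->
    (forall p, p != 0 -> exists i, ~~ (restr <[p]> <= tnth U i)%VS) ->
  minimal_code b D <->
  (forall p p', (forall i, (restr <[p']> <= tnth U i + restr <[p]>)%VS) -> p' \in <[p]>%VS).
Proof.
move=> basis_b memD noL.
have suppE p p' : support_sub b (dual_word G p') (dual_word G p) <->
    forall i, (restr <[p']> <= tnth U i + restr <[p]>)%VS.
  by split=> H i; have := H i; rewrite !mxrowK (sub_line_form_word (basisG i)).
split=> [minD p p' /suppE sp | geom c c' /memD[p ->] /memD[p' ->] /suppE /geom /vlineP[a ->]].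
  have [||a w'E] := minD _ _ _ _ sp; try by apply/memD; eexists.
  have [l lE] := rmorph_surj theta a; apply/vlineP; exists l.
  apply/eqP; rewrite -subr_eq0; apply: contraT => /noL[i /negP[]].
  by apply: dual_word_eq0; rewrite dual_wordB dual_wordZ lE w'E subrr.
by exists (theta a); rewrite dual_wordZ.
Qed.
End Blocks.
End DualCodewords.

(** * The AB-condition and block weights *)

Lemma AB_conditionE (F : finFieldType) (L : splittingFieldType F) (t : nat) (n : 'I_t -> nat)
    (D : code L n) (dM dm : rat) :
  AB_max D dM -> AB_min D dm ->
  AB_condition D <-> dM / dm < (#|F| ^ \dim {:L})%:R / ((#|F| ^ \dim {:L})%:R - 1).
Proof.
move=> maxM minm; split=> [[dM' [dm' [maxM' minm']]]|]; last by exists dM, dm.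
have -> : dM' = dM.
  case: maxM maxM' => [[c [Dc c_nz ->]] leM] [[c' [Dc' c'_nz ->]] leM'].
  by apply: le_anti; rewrite leM ?leM'.
have -> // : dm' = dm.
case: minm minm' => [[c [Dc c_nz ->]] lem] [[c' [Dc' c'_nz ->]] lem'].
by apply: le_anti; rewrite lem ?lem'.
Qed.

(* [(q^(2m) - q^(m + c)) / (q - 1)] is the contribution of a block of length [2m]
   and rank [m - c] to the AB-weight. *)
Definition block_weight (q m c : nat) : rat :=
  ((q ^ (2 * m))%:R - (q ^ (m + c))%:R) / (q%:R - 1).

(* With [Q = q^m], clearing denominators turns the AB-inequality into
   [2 < (3 - q) Q]. *)
Lemma block_weight_ratio (q m : nat) : (1 < q)%N -> (1 < m)%N ->
  (block_weight q m 0 + block_weight q m 0) / (block_weight q m 0 + block_weight q m 1)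
     < (q ^ m)%:R / ((q ^ m)%:R - 1) <-> q = 2%N.
Proof.
move=> q_gt1 m_gt1; have lt_qQ : (q < q ^ m)%N by rewrite -{1}(expn1 q) ltn_exp2l.
rewrite /block_weight mul2n -addnn addn0 addn1 expnD expnS !natrM.
have [Q1 q1] : 2 < (q ^ m)%:R :> rat /\ 1 < q%:R :> rat.
  by rewrite ltr1n ltr_nat (leq_ltn_trans _ lt_qQ).
have qQ : q%:R < (q ^ m)%:R :> rat by rewrite ltr_nat.
have q23 : q = 2%N /\ q%:R = 2 :> rat \/ q <> 2%N /\ 3 <= q%:R :> rat.
  have [->|/eqP q_neq2] := eqVneq q 2%N; [by left | right; split=> //].
  by rewrite ler_nat; lia.
move: (q ^ m)%:R (q%:R : rat) Q1 q1 qQ q23 => Q r Q1 r1 rQ q23.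
have M1_gt0 : 0 < (Q * Q - Q) / (r - 1) + (Q * Q - r * Q) / (r - 1).
  by rewrite -mulrDl divr_gt0; nra.
rewrite ltr_pdivrMr // mulrAC ltr_pdivlMr; last by lra.
rewrite -subr_gt0 [X in 0 < X](_ : _ = Q * ((3 - r) * Q - 2) / (r - 1)); last by field; lra.
rewrite pmulr_lgt0 ?invr_gt0 ?subr_gt0 // pmulr_rgt0; last by lra.
(* For [r = 2] the condition is [2 < Q], which [m > 1] ensures; for [r >= 3] the product
   [(3 - r) * Q] is at most 0. *)
case: q23 => [] [qE rE]; split=> //; first by rewrite rE => _; lra.
by move=> pos; exfalso; nra.
Qed.

Lemma block_weight_le (q m : nat) : (1 < q)%N ->
  block_weight q m 1 <= block_weight q m 0.
Proof.
move=> q_gt1; rewrite ler_pM2r ?invr_gt0 ?subr_gt0 ?ltr1n //.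
by rewrite lerD2l lerN2 ler_nat leq_exp2l // addn0 addn1.
Qed.

Lemma AB_weight_dual_word (F : finFieldType) (L : splittingFieldType F)
    (theta : {rmorphism L -> L})
    (sigma : {bilinear Lvec L 3 -> Lvec L 3 -> L | *%R & theta \; *%R})
    (t : nat) (U : t.-tuple {vspace Fvec L 3}) (n : 'I_t -> nat)
    (G : forall i, 'M[L]_(3, n i)) (p : Lvec L 3) :
    nondegenerate_form sigma ->
    (forall i, basis_of (perp sigma (tnth U i)) [seq Fcol (G i) j | j : 'I_(n i)]) ->
    (forall i, \dim (tnth U i) = \dim {:L}) -> p != 0 ->
  AB_weight F n (rank_list (dual_word sigma G p)) =
  \sum_i block_weight #|F| (\dim {:L}) (\dim (tnth U i :&: restr <[p]>)).
Proof.
move=> sigma_nondeg basisG dimU p_nz; apply: eq_bigr => i _.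
rewrite /rank_list mxrowK /block_weight.
have := block_length sigma_nondeg (basisG i).
have := rk_form_word sigma_nondeg (basisG i) p_nz; rewrite dimU.
set r := rk _; set c := \dim (_ :&: _) => rc nE.
(* The complement of an [m]-dimensional subspace of the [3m]-dimensional space has dimension
   [2m]. *)
have -> : n i = (2 * \dim {:L})%N by lia.
by have -> : (2 * \dim {:L} - r = \dim {:L} + c)%N by lia.
Qed.

(** * The dual code of two scattered subspaces in distinct planes *)

Section TwoScatteredSubspaces.
Variables (F : finFieldType) (L : splittingFieldType F).
Local Notation m := (\dim {:L}).
Hypothesis m_gt1 : (1 < m)%N.
Variable theta : {rmorphism L -> L}.
Variable sigma : {bilinear Lvec L 3 -> Lvec L 3 -> L | *%R & theta \; *%R}.
Hypothesis sigma_refl : reflexive_form sigma.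
Hypothesis sigma_nondeg : nondegenerate_form sigma.

Lemma spanning_perp t (U : t.-tuple {vspace Fvec L 3}) (i : 'I_t) :
  scattered (tnth U i) -> spanning (map_tuple (perp sigma) U).
Proof.
move=> scU; apply/eqP; rewrite eqEsubv subvf /= (sumv_sup i) // tnth_map.
by rewrite (Lspan_perp sigma_refl sigma_nondeg) // => p; apply: scattered_no_line.
Qed.

Lemma scattered_perp_not_minimal (b : m.-tuple L) (U : {vspace Fvec L 3})
    (W : {vspace Lvec L 3}) (n : 'I_1 -> nat) (C : code L n) :
    basis_of {:L} b -> scattered U -> \dim U = m -> \dim W = 2%N -> (U <= restr W)%VS ->
  associated [tuple perp sigma U] C -> ~ minimal_code b C.
Proof.
move=> basis_b scU dimU dimW sUW.
(* In this form the criterion for dual codes applies with a single block. *)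
rewrite (_ : [tuple _] = map_tuple (perp sigma) [tuple U]); last exact: val_inj.
case/(dual_codewords sigma_refl sigma_nondeg) => G [basisG memC].
have noL p : p != 0 -> exists i, ~~ (restr <[p]> <= tnth [tuple U] i)%VS.
  by exists 0; apply: scattered_no_line.
move/(minimal_dual_codeP sigma_nondeg basisG basis_b memC noL) => geom.
have [p [p' [/negP p'Np sp']]] := exists_line_in_sum dimW dimU sUW.
by apply: p'Np; apply: geom => i; rewrite (ord1 i).
Qed.

Variables (W1 W2 : {vspace Lvec L 3}) (U1 U2 : {vspace Fvec L 3}).
Hypotheses (dimW1 : \dim W1 = 2%N) (dimW2 : \dim W2 = 2%N) (W12 : W1 != W2).
Hypotheses (U1W1 : (U1 <= restr W1)%VS) (U2W2 : (U2 <= restr W2)%VS).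
Hypotheses (scU1 : scattered U1) (scU2 : scattered U2).
Hypotheses (dimU1 : \dim U1 = m) (dimU2 : \dim U2 = m).

Lemma spanning_scattered_planes : spanning [tuple U1; U2].
Proof.
rewrite /spanning !big_ord_recl big_ord0 addv0 /=.
rewrite [tnth _ _]/= (Lspan_scattered scU1 _ dimW1 U1W1) ?dimU1 //.
rewrite [tnth _ _]/= (Lspan_scattered scU2 _ dimW2 U2W2) ?dimU2 //.
apply/eqP; rewrite eqEdim subvf dim_Lvec ltnNge; apply: contra W12 => dimW12.
have /eqP -> : W1 == (W1 + W2)%VS by rewrite eqEdim addvSl dimW1.
by rewrite eq_sym eqEdim addvSr dimW2.
Qed.

(** Ensures that claims about all geometric duals are not vacuous; a point inside the intersection
    would lie in the scattered [U1]. *)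
Lemma geometric_dual_exists :
  exists (n : 'I_2 -> nat) (D : code L n), geometric_dual sigma [tuple U1; U2] D.
Proof.
have [n [D assocD]] := associated_exists (spanning_perp (i := 0) (U := [tuple U1; U2]) scU1).
exists n, D; split=> //; first exact: spanning_scattered_planes.
case=> P [dimP sP]; have P_nz : vpick P != 0 by rewrite vpick0 -dimv_eq0 dimP.
have defP : <[vpick P]>%VS = P by apply/eqP; rewrite eqEdim -memvE memv_pick dim_vline P_nz dimP.
have /negP[] := scattered_no_line m_gt1 scU1 P_nz.
by rewrite defP; apply: subv_trans sP _; apply: (@bigcapv_inf _ _ _ 0).
Qed.

Section CodewordParametrization.
Variables (n : 'I_2 -> nat) (D : code L n) (G : forall i, 'M[L]_(3, n i)).
Hypothesis basisG :
  forall i, basis_of (perp sigma (tnth [tuple U1; U2] i)) [seq Fcol (G i) j | j : 'I_(n i)].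
Hypothesis memD : forall c, c \in D <-> exists p, c = dual_word sigma G p.

Lemma geometric_dual_minimal (b : m.-tuple L) : basis_of {:L} b -> minimal_code b D.
Proof.
move=> basis_b; apply/(minimal_dual_codeP sigma_nondeg basisG basis_b memD).
  by exists 0; apply: scattered_no_line.
move=> p p' sp'; apply: (scattered_planes_line m_gt1 dimW1 dimW2 W12 scU1 scU2) => //.
  exact: sp' 0.
exact: sp' 1.
Qed.

Hypothesis disU : disjoint_linear_sets U1 U2.
Local Notation w := (block_weight #|F| m).
Let q_gt1 : (1 < #|F|)%N. Proof. exact: finNzRing_gt1. Qed.

Lemma geometric_dual_weight p : p != 0 ->
  AB_weight F n (rank_list (dual_word sigma G p)) =
  w (\dim (U1 :&: restr <[p]>)) + w (\dim (U2 :&: restr <[p]>)).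
Proof.
move=> p_nz; rewrite (AB_weight_dual_word sigma_nondeg basisG) //.
  by rewrite !big_ord_recl big_ord0 addr0.
by case=> [[|[|//]] ?].
Qed.

Lemma dual_word_neq0 p : (dual_word sigma G p != 0) = (p != 0).
Proof.
apply/idP/idP; [apply: contraNneq => -> | apply: contraNneq => w0].
  by apply/eqP/rowP=> j; rewrite !mxE (linear0r sigma).
have [//|p_nz] := eqVneq p 0.
by have /negP[] := scattered_no_line m_gt1 scU1 p_nz; exact: (dual_word_eq0 sigma_nondeg basisG 0 w0).
Qed.

(** Disjointness lets at most one of [U1], [U2] meet the point, and scatteredness bounds that
    intersection by dimension 1. *)
Lemma geometric_dual_weights p : p != 0 ->
  AB_weight F n (rank_list (dual_word sigma G p)) = w 0 + w 0 \/
  AB_weight F n (rank_list (dual_word sigma G p)) = w 0 + w 1.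
Proof.
move=> p_nz; rewrite geometric_dual_weight //.
have [] := cap_disjoint_linear_sets disU p_nz => ->; rewrite dimv0.
  have := scU2 p_nz; case: (\dim _) => [|[|//]] _; by [left | right].
have := scU1 p_nz; case: (\dim _) => [|[|//]] _; by [left | right; rewrite addrC].
Qed.

Lemma geometric_dual_AB_max : AB_max D (w 0 + w 0).
Proof.
have [p [p_nz U1p U2p]] := exists_line_off_planes dimW1 dimW2 W12 U1W1 U2W2.
split=> [|c /memD[p' ->]]; last first.
  rewrite dual_word_neq0 => /geometric_dual_weights[] -> //.
  by rewrite lerD2l block_weight_le.
exists (dual_word sigma G p); split; first by apply/memD; exists p.
  by rewrite dual_word_neq0.
by rewrite geometric_dual_weight // U1p U2p dimv0.
Qed.

Lemma geometric_dual_AB_min : AB_min D (w 0 + w 1).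
Proof.
split=> [|c /memD[p' ->]]; last first.
  rewrite dual_word_neq0 => /geometric_dual_weights[] -> //.
  by rewrite lerD2l block_weight_le.
(* Any nonzero vector of [U1] spans a point of its linear set, giving the rank-list [(m-1, m)]. *)
have p_nz : vpick U1 != 0 by rewrite vpick0 -dimv_eq0 dimU1 -lt0n ltnW.
pose p : Lvec L 3 := vpick U1.
exists (dual_word sigma G p); split; first by apply/memD; exists p.
  by rewrite dual_word_neq0.
have U1p : (U1 :&: restr <[p]> != 0)%VS.
  apply: contraNneq p_nz => U1p0; rewrite -memv0 -U1p0 memv_cap memv_pick mem_restr.
  exact: memv_line.
rewrite geometric_dual_weight // addrC.
have [U1p0|->] := cap_disjoint_linear_sets disU (p_nz : p != 0).
  by rewrite U1p0 eqxx in U1p.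
have /eqP-> : \dim (U1 :&: restr <[p]>) == 1%N.
  by rewrite eqn_leq scU1 // lt0n dimv_eq0.
by rewrite dimv0.
Qed.

Lemma geometric_dual_AB : AB_condition D <-> #|F| = 2%N.
Proof.
apply: iff_trans (AB_conditionE geometric_dual_AB_max geometric_dual_AB_min) _.
exact: block_weight_ratio.
Qed.
End CodewordParametrization.
End TwoScatteredSubspaces.

Theorem theorem4p22 (F : finFieldType) (L : splittingFieldType F) (m : nat)
  (hm : \dim {:L} = m) (m_ge2 : (2 <= m)%N)
  (b : m.-tuple L) (hb : basis_of {:L} b)
  (theta : {rmorphism L -> L})
  (sigma : {bilinear Lvec L 3 -> Lvec L 3 -> L | *%R & theta \; *%R})
  (sigma_refl : reflexive_form sigma) (sigma_nondeg : nondegenerate_form sigma)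
  (W1 W2 : {vspace Lvec L 3})
  (dimW1 : \dim W1 = 2%N) (dimW2 : \dim W2 = 2%N) (W12 : W1 != W2)
  (U1 U2 : {vspace Fvec L 3})
  (U1W1 : (U1 <= restr W1)%VS) (U2W2 : (U2 <= restr W2)%VS)
  (scU1 : scattered U1) (scU2 : scattered U2)
  (dimU1 : \dim U1 = m) (dimU2 : \dim U2 = m)
  (disU : disjoint_linear_sets U1 U2) :
  [/\ (exists (n : 'I_2 -> nat) (D : code L n),
         geometric_dual sigma [tuple U1; U2] D),
      (forall (n : 'I_2 -> nat) (D : code L n),
         geometric_dual sigma [tuple U1; U2] D ->
         minimal_code b D /\ (AB_condition D <-> #|F| = 2%N))
    & (forall U : {vspace Fvec L 3}, U = U1 \/ U = U2 ->
         (exists (n : 'I_1 -> nat) (C : code L n),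
            associated [tuple perp sigma U] C) /\
         (forall (n : 'I_1 -> nat) (C : code L n),
            associated [tuple perp sigma U] C -> ~ minimal_code b C))].
Proof.
subst m; split.
- exact: (geometric_dual_exists m_ge2 sigma_refl sigma_nondeg dimW1 dimW2 W12).
- move=> n D [_ _ /(dual_codewords sigma_refl sigma_nondeg)[G [basisG memD]]]; split.
    exact: (geometric_dual_minimal m_ge2 sigma_nondeg dimW1 dimW2 W12 _ _ scU1 scU2 _ _ basisG).
  exact: (geometric_dual_AB m_ge2 sigma_nondeg dimW1 dimW2 W12 _ _ scU1 scU2 _ _ basisG).
(* Both subspaces are treated at once: only scatteredness, the dimension and some plane containing
   [U] matter. *)
move=> U UU; have [scU [dimU [W [dimW sUW]]]] : scattered U /\ \dim U = \dim {:L} /\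
    exists W : {vspace Lvec L 3}, \dim W = 2%N /\ (U <= restr W)%VS.
  by case: UU => ->; split=> //; split=> //; [exists W1 | exists W2].
split; last first.
  by move=> n C; apply: (scattered_perp_not_minimal m_ge2 sigma_refl sigma_nondeg hb scU dimU dimW).
rewrite (_ : [tuple _] = map_tuple (perp sigma) [tuple U]); last exact: val_inj.
exact/associated_exists/(spanning_perp m_ge2 sigma_refl sigma_nondeg (i := 0)).
Qed.
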